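(* Let $(X,d)$ be a finite metric space with cardinality $n = |X| \geq 3$. Let $\mathfrak{D} = (\operatorname{diam} X) / \min \{d(x,y) : x,y\in X,\ x \neq y\}$ denote the scaled diameter of $(X,d)$, where $\operatorname{diam} X = \max_{x,y\in X} d(x,y)$. Let $\Gamma = \Gamma_X^0$ be the (normalized) $0$-negative type gap of $(X,d)$, and put $$\zeta = \frac{\ln\bigl(\frac{1}{1-\Gamma}\bigr)}{\ln \mathfrak{D}},$$ with the convention that $\zeta = +\infty$ (and $[0,\zeta]=[0,\zeta)=[0,\infty)$) if $\mathfrak{D}=1$. Then $(X,d)$ has $p$-negative type for all $p \in [0,\zeta]$. Moreover, $(X,d)$ has strict $p$-negative type for all $p \in [0,\zeta)$.
   Context: Convention for exponent $p=0$: $d(x,y)^0 = 1$ if $x\neq y$, and $d(x,x)^0 = 0$. Let $p \geq 0$ and let $(X,d)$ be a metric space. (a) $(X,d)$ has $p$-negative type if for all natural numbers $k \geq 2$, all finite subsets $\{x_1,\ldots,x_k\} \subseteq X$ (of $k$ distinct points), and all real numbers $\eta_1,\ldots,\eta_k$ with $\eta_1+\cdots+\eta_k = 0$, one has $\sum_{1\le i,j\le k} d(x_i,x_j)^p \eta_i\eta_j \leq 0$. (b) $(X,d)$ has strict $p$-negative type if it has $p$-negative type and the inequalities in (a) are all strict except when $(\eta_1,\ldots,\eta_k) = (0,\ldots,0)$. For positive integers $q,t$, a normalized $(q,t)$-simplex $D(\vec\omega)=[a_j(m_j);b_i(n_i)]_{q,t}$ in $X$ consists of $q+t$ distinct points $a_1,\ldots,a_q,b_1,\ldots,b_t\in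 X$ together with a vector $\vec\omega=(m_1,\ldots,m_q,n_1,\ldots,n_t)$ of (strictly) positive real numbers such that $m_1+\cdots+m_q = 1 = n_1+\cdots+n_t$. Its $p$-negative type simplex gap is $$\gamma_D^p(\vec\omega) = \sum_{j=1}^{q}\sum_{i=1}^{t} m_j n_i d(a_j,b_i)^p - \sum_{1\le j_1<j_2\le q} m_{j_1}m_{j_2}d(a_{j_1},a_{j_2})^p - \sum_{1\le i_1<i_2\le t} n_{i_1}n_{i_2}d(b_{i_1},b_{i_2})^p.$$ Sums over the empty set are zero. If $(X,d)$ has $p$-negative type, its (normalized) $p$-negative type gap is $\Gamma_X^p = \inf_{D(\vec\omega)} \gamma_D^p(\vec\omega)$, the infimum being over all $q,t\ge 1$ and all normalized $(q,t)$-simplices $D(\vec\omega)$ in $X$. Every metric space has $0$-negative type, so $\Gamma_X^0$ is defined. *)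

(* Defs.v *)
From HB Require Import structures.
From mathcomp Require Import all_boot all_order all_algebra.
From mathcomp Require Import all_classical all_reals all_analysis.

Set Implicit Arguments.
Unset Strict Implicit.
Unset Printing Implicit Defensive.

Import Order.TTheory GRing.Theory Num.Theory.

Local Open Scope classical_set_scope.
Local Open Scope ring_scope.

Section NegativeType.
Context {R : realType} (X : metricType R).

(* d(x,y)^p.  The case p = 0 is separate because 0 `^ 0 = 1 in the library,
   whereas d(x,x)^0 is 0 here. *)
Definition dist_pow (p : R) (x y : X) : R :=
  if p == 0 then (x != y)%:R else mdist x y `^ p.

Definition negative_type (p : R) : Prop :=
  forall (k : nat) (x : 'I_k -> X) (eta : 'I_k -> R),
    (2 <= k)%N -> injective x -> \sum_(i < k) eta i = 0 ->
    \sum_(i < k) \sum_(j < k) dist_pow p (x i) (x j) * eta i * eta j <= 0.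

Definition strict_negative_type (p : R) : Prop :=
  negative_type p /\
  forall (k : nat) (x : 'I_k -> X) (eta : 'I_k -> R),
    (2 <= k)%N -> injective x -> \sum_(i < k) eta i = 0 ->
    (exists i, eta i != 0) ->
    \sum_(i < k) \sum_(j < k) dist_pow p (x i) (x j) * eta i * eta j < 0.

Record simplex (q t : nat) := Simplex {
  pta : 'I_q -> X;
  ptb : 'I_t -> X;
  wta : 'I_q -> R;
  wtb : 'I_t -> R;
  pta_inj : injective pta;
  ptb_inj : injective ptb;
  pta_neq_ptb : forall j i, pta j != ptb i;
  wta_gt0 : forall j, 0 < wta j;
  wtb_gt0 : forall i, 0 < wtb i;
  wta_sum : \sum_(j < q) wta j = 1;
  wtb_sum : \sum_(i < t) wtb i = 1
}.

Definition simplex_gap (p : R) (q t : nat) (D : simplex q t) : R :=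
  \sum_(j < q) \sum_(i < t)
    wta D j * wtb D i * dist_pow p (pta D j) (ptb D i)
  - \sum_(j1 < q) \sum_(j2 < q | (j1 < j2)%N)
      wta D j1 * wta D j2 * dist_pow p (pta D j1) (pta D j2)
  - \sum_(i1 < t) \sum_(i2 < t | (i1 < i2)%N)
      wtb D i1 * wtb D i2 * dist_pow p (ptb D i1) (ptb D i2).

(* Meaningful when X has p-negative type and at least two points: the set is
   then nonempty and bounded below by 0 (inf is 0 by default otherwise). *)
Definition negative_type_gap (p : R) : R :=
  inf [set g | exists (q t : nat) (D : simplex q t),
    [/\ (0 < q)%N, (0 < t)%N & g = simplex_gap p D]].

(* The sup and the inf below are a max and a min when X is finite and has at
   least two points. *)
Definition diam : R := sup [set r | exists x y : X, r = mdist x y].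

Definition min_dist : R :=
  inf [set r | exists x y : X, x != y /\ r = mdist x y].

Definition scaled_diam : R := diam / min_dist.

Definition zeta : \bar R :=
  if scaled_diam == 1 then +oo%E
  else (ln (1 / (1 - negative_type_gap 0)) / ln scaled_diam)%:E.

End NegativeType.

(* Main.v *)
Require Import Defs.
From mathcomp Require Import all_boot all_order all_algebra.
From mathcomp Require Import all_classical all_reals all_analysis.
From mathcomp Require Import ring lra.

Import Order.TTheory GRing.Theory Num.Theory.

Local Open Scope classical_set_scope.
Local Open Scope ring_scope.

(** For p = 0 the simplex gap is half the sum of the squared weights.  Scaling
    the positive and the negative part of eta to total mass 1 thus gives
    2 s^2 Gamma <= sum_i eta_i^2, where s is the sum of the positive eta_i.
    With lo = (min d)^p and hi = (diam X)^p, the p-form at eta is at most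
    hi (2 s^2 - sum_i eta_i^2) - 2 s^2 lo <= 2 s^2 (hi (1 - Gamma) - lo), and
    p <= zeta says precisely that hi (1 - Gamma) <= lo.  The weights
    (2, -1, -1) show Gamma <= 3/4, so that 1 - Gamma > 0. *)

(** * Enumerations and sums over pairs *)

Lemma card_setT_ord_bij (T : Type) (n : nat) :
  ([set: T] #= `I_n)%card -> exists f : 'I_n -> T, bijective f.
Proof.
move=> /card_bijP[f [g fK gK]].
pose s (i : 'I_n) : set_type `I_n :=
  SigSub (mem_set (ltn_ord i : `I_n i)).
pose u (x : T) : set_type [set: T] := SigSub (mem_set (I : [set: T] x)).
have lt_f x : (val (f (u x)) < n)%N by exact: set_valP (f (u x)).
exists (fun i => val (g (s i))); exists (fun x => Ordinal (lt_f x)).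
- move=> i; apply: val_inj => /=.
  have -> : u (val (g (s i))) = g (s i) by apply: val_inj.
  by rewrite gK.
- move=> x /=.
  have -> : s (Ordinal (lt_f x)) = f (u x) by apply: val_inj.
  by rewrite fK.
Qed.

(** Expand the square of the total mass 1: it is the diagonal plus two triangles, equal by
    symmetry. *)
Lemma sum_lt_pairs (R : realType) (q : nat) (m : 'I_q -> R) :
  \sum_(i < q) m i = 1 ->
  \sum_(i < q) \sum_(j < q | (i < j)%N) m i * m j
    = (1 - \sum_(i < q) m i ^+ 2) / 2.
Proof.
move=> m1.
set S := LHS.
have E : \sum_(i < q) \sum_(j < q) m i * m j = 1.
  under eq_bigr do rewrite -mulr_sumr m1 mulr1.
  exact: m1.
have D (i : 'I_q) : \sum_(j < q) m i * m j = m i ^+ 2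
   + (\sum_(j < q | (i < j)%N) m i * m j + \sum_(j < q | (j < i)%N) m i * m j).
  rewrite (bigD1 i) //= expr2; congr (_ + _).
  rewrite (bigID (fun j : 'I_q => (i < j)%N)) /=; congr (_ + _);
    apply: eq_bigl => j; rewrite -val_eqE /=; by case: ltngtP.
have S' : \sum_(i < q) \sum_(j < q | (j < i)%N) m i * m j = S.
  rewrite (exchange_big_dep predT) //=; apply: eq_bigr => i _; apply: eq_bigr => j _.
  exact: mulrC.
move: E; under eq_bigr do rewrite D.
by rewrite !big_split /= S' -/S => E; lra.
Qed.

(** * The gap at exponent 0 *)

Section Gap.
Context {R : realType} (X : metricType R).

(** All points of a simplex are at 0-th power distance 1, so the mixed sum is 1 and each remaining
    sum is given by [sum_lt_pairs]. *)
Lemma simplex_gap0E q t (D : simplex X q t) :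
  simplex_gap 0 D = (\sum_j wta D j ^+ 2 + \sum_i wtb D i ^+ 2) / 2.
Proof.
have inj_sum r (x : 'I_r -> X) (w : 'I_r -> R) : injective x ->
    \sum_(i < r) \sum_(j < r | (i < j)%N) w i * w j * dist_pow 0 (x i) (x j)
    = \sum_(i < r) \sum_(j < r | (i < j)%N) w i * w j.
  move=> xI; apply: eq_bigr => i _; apply: eq_bigr => j ij.
  rewrite /dist_pow eqxx (inj_eq xI).
  by rewrite -val_eqE /= ltn_eqF ?mulr1.
rewrite /simplex_gap !inj_sum; [|exact: ptb_inj|exact: pta_inj].
rewrite !sum_lt_pairs; [|exact: wtb_sum|exact: wta_sum].
have -> : \sum_(j < q) \sum_(i < t)
    wta D j * wtb D i * dist_pow 0 (pta D j) (ptb D i) = 1.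
  under eq_bigr => j _.
    under eq_bigr => i _ do rewrite /dist_pow eqxx pta_neq_ptb mulr1.
    rewrite -mulr_sumr wtb_sum mulr1; over.
  exact: wta_sum.
by field.
Qed.

Lemma gap0_le q t (D : simplex X q t) : (0 < q)%N -> (0 < t)%N ->
  negative_type_gap X 0 <= simplex_gap 0 D.
Proof.
move=> q0 t0; apply: ge_inf; last by exists q, t, D.
(* The infimum bounds its set from below only once some lower bound is known; half a sum of squares
   is at least 0. *)
exists 0 => _ [q' [t' [D' [_ _ ->]]]].
by rewrite simplex_gap0E divr_ge0// addr_ge0// sumr_ge0// => i _; rewrite sqr_ge0.
Qed.

Lemma gap0_sum_sqr (k : nat) (x : 'I_k -> X) (eta : 'I_k -> R) :
  injective x -> \sum_i eta i = 0 ->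
  negative_type_gap X 0 * (2 * (\sum_(i | 0 < eta i) eta i) ^+ 2)
    <= \sum_i eta i ^+ 2.
Proof.
move=> xI eta0; set s := \sum_(i | _) _.
have sN : \sum_(i | eta i < 0) - eta i = s.
  rewrite sumrN; apply/eqP; rewrite -subr_eq0 -opprD oppr_eq0 addrC; apply/eqP.
  rewrite -[RHS]eta0 [RHS](bigID (fun i => 0 < eta i)) /=; congr (_ + _).
  rewrite [RHS](bigID (fun i => eta i < 0)) /= [X in _ + X]big1 ?addr0.
    by apply: eq_bigl => i; case: ltgtP.
  by move=> i; case: ltgtP.
have s_ge0 : 0 <= s by apply: sumr_ge0 => i /ltW.
(* When [s] is 0 there is no mass to normalize, but the left side vanishes. *)
have [s0|s_gt0] : s = 0 \/ 0 < s.
  by move: s_ge0; rewrite le_eqVlt => /predU1P[]; [left|right].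
  by rewrite s0 expr0n/= !mulr0 sumr_ge0// => i _; rewrite sqr_ge0.
(* The simplex has its two vertex families where [eta] is positive and negative; by [sN] both parts
   have mass [s], so dividing by [s] normalizes each. *)
pose A := [pred i | 0 < eta i]; pose B := [pred i | eta i < 0].
pose a (j : 'I_#|A|) := x (enum_val j); pose b (j : 'I_#|B|) := x (enum_val j).
pose m (j : 'I_#|A|) := eta (enum_val j) / s.
pose w (j : 'I_#|B|) := - eta (enum_val j) / s.
have aI : injective a by move=> i j /xI/enum_val_inj.
have bI : injective b by move=> i j /xI/enum_val_inj.
have eA (j : 'I_#|A|) : 0 < eta (enum_val j) := enum_valP j.
have eB (j : 'I_#|B|) : eta (enum_val j) < 0 := enum_valP j.
have ab j i : a j != b i.
  rewrite (inj_eq xI); apply/eqP => E.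
  by have := eA j; rewrite E => /lt_trans/(_ (eB i)); rewrite ltxx.
have m_gt0 j : 0 < m j by rewrite divr_gt0.
have w_gt0 j : 0 < w j by rewrite divr_gt0 // oppr_gt0.
have m1 : \sum_j m j = 1.
  by rewrite -mulr_suml -(big_enum_val (A := A) eta) divff // gt_eqF.
have w1 : \sum_j w j = 1.
  by rewrite -mulr_suml -(big_enum_val (A := B) (fun i => - eta i))
    [X in X / _]sN divff // gt_eqF.
have q0 : (0 < #|A|)%N.
  rewrite lt0n; apply/eqP => A0; move: s_gt0; rewrite /s big_pred0 ?ltxx//.
  exact: card0_eq A0.
have t0 : (0 < #|B|)%N.
  rewrite lt0n; apply/eqP => B0; move: s_gt0; rewrite -sN big_pred0 ?ltxx//.
  exact: card0_eq B0.
have := gap0_le _ _ (Simplex aI bI ab m_gt0 w_gt0 m1 w1) q0 t0.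
rewrite simplex_gap0E /=.
have -> : \sum_j m j ^+ 2 + \sum_i w i ^+ 2 = (\sum_i eta i ^+ 2) / s ^+ 2.
  under eq_bigr do rewrite exprMn exprVn.
  under [X in _ + X]eq_bigr do rewrite exprMn exprVn sqrrN.
  rewrite -!mulr_suml -mulrDl; congr (_ / _).
  rewrite -(big_enum_val (A := A) (fun i => eta i ^+ 2)).
  rewrite -(big_enum_val (A := B) (fun i => eta i ^+ 2)) /=.
  (* Indices outside [A] and [B] have [eta i = 0] and add nothing to the squares. *)
  rewrite [RHS](bigID (mem A)) /=; congr (_ + _).
  rewrite [RHS](bigID (mem B)) /= [X in _ = _ + X]big1 ?addr0.
    by apply: eq_bigl => i; rewrite !inE; case: ltgtP.
  by move=> i; rewrite !inE; case: ltgtP => // <- _; rewrite expr0n.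
by rewrite -mulrA -invfM ler_pdivlMr ?mulr_gt0 ?exprn_gt0// [s ^+ 2 * _]mulrC.
Qed.

(** The weak inequality follows from the strict one, since the form vanishes at [eta = 0]. *)
Lemma strict_negative_type_of_form (p : R) :
  (forall (k : nat) (x : 'I_k -> X) (eta : 'I_k -> R),
    injective x -> \sum_i eta i = 0 -> (exists i, eta i != 0) ->
    \sum_(i < k) \sum_(j < k) dist_pow p (x i) (x j) * eta i * eta j < 0) ->
  strict_negative_type X p.
Proof.
move=> form; split=> k x eta _ xI eta0; last exact: form.
have [e|e] := pselect (exists i, eta i != 0); first exact/ltW/form.
have {}e i : eta i = 0 by apply/eqP; apply: contrapT => /negP ei; apply: e; exists i.
by rewrite big1 // => i _; rewrite big1 // => j _; rewrite !e !mulr0.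
Qed.

(** * Estimates of the quadratic form *)

Section Form.
Variables (lo hi p : R).
Hypothesis dist_pow_bounds :
  forall x y : X, x != y -> lo <= dist_pow p x y <= hi.

(* Off the diagonal, pairs of equal sign are estimated by [hi] and pairs of
   opposite sign by [lo]; the diagonal terms vanish on the left and contribute
   [hi * eta i ^+ 2] on the right. *)
Lemma form_le (k : nat) (x : 'I_k -> X) (eta : 'I_k -> R) :
  0 <= p -> injective x -> \sum_i eta i = 0 ->
  \sum_(i < k) \sum_(j < k) dist_pow p (x i) (x j) * eta i * eta j
  <= 2 * (\sum_(i | 0 < eta i) eta i) ^+ 2 * (hi - lo)
     - hi * \sum_i eta i ^+ 2.
Proof.
move=> p0 xI eta0.
(* Positive and negative parts of [eta]; their supports are disjoint and both have total mass
   [s]. *)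
pose u i := Num.max (eta i) 0; pose v i := Num.max (- eta i) 0.
have sE : \sum_(i | 0 < eta i) eta i = \sum_i u i.
  by rewrite big_mkcond; apply: eq_bigr => i _; rewrite /u; case: ltgtP.
have uvE i : eta i = u i - v i.
  rewrite /u /v; have /orP[e|e] := le_total 0 (eta i).
    by rewrite max_l // max_r ?oppr_le0 // subr0.
  by rewrite max_r // max_l ?oppr_ge0 // sub0r opprK.
have svE : \sum_i v i = \sum_i u i.
  by apply/eqP; rewrite eq_sym -subr_eq0 -sumrB; under eq_bigr do rewrite -uvE;
    rewrite eta0.
have u0 i : 0 <= u i by rewrite le_max lexx orbT.
have v0 i : 0 <= v i by rewrite le_max lexx orbT.
rewrite sE; set s := \sum_i u i.
(* [F] dominates the summand off the diagonal and equals [hi * eta i ^+ 2] on it, because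
   [u i * v i = 0]. Its full double sum is [2 * s ^+ 2 * (hi - lo)]. *)
pose F i j := hi * (u i * u j + v i * v j) - lo * (u i * v j + v i * u j).
have -> : 2 * s ^+ 2 * (hi - lo) - hi * \sum_i eta i ^+ 2 =
    \sum_i (\sum_j F i j - hi * eta i ^+ 2).
  rewrite sumrB -mulr_sumr; congr (_ - _).
  have FE i : \sum_j F i j = (hi - lo) * s * (u i + v i).
    rewrite sumrB -!mulr_sumr !big_split /= -!mulr_sumr svE -/s; ring.
  under eq_bigr do rewrite FE.
  by rewrite -mulr_sumr big_split /= svE -/s; ring.
apply: ler_sum => i _; rewrite (bigD1 i) //= [X in _ <= X - _](bigD1 i) //=.
have uv0 : u i * v i = 0.
  rewrite /u /v; have /orP[e|e] := le_total 0 (eta i).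
    by rewrite [X in _ * X]max_r ?mulr0 ?oppr_le0.
  by rewrite max_r // mul0r.
have -> : F i i = hi * eta i ^+ 2.
  by rewrite /F uvE [v i * u i]mulrC uv0 sqrrB uv0 mul0rn !expr2; ring.
have -> : dist_pow p (x i) (x i) = 0.
  by rewrite /dist_pow eqxx mdistxx /powR eqxx; case: eqP => // /eqP->.
rewrite !mul0r add0r addrAC subrr add0r; apply: ler_sum => j ji.
have /andP[dlo dhi] : lo <= dist_pow p (x i) (x j) <= hi.
  by apply: dist_pow_bounds; rewrite (inj_eq xI) eq_sym.
rewrite (uvE i) (uvE j) /F; set d := dist_pow _ _ _ in dlo dhi *.
have h1 := ler_wpM2r (mulr_ge0 (u0 i) (u0 j)) dhi.
have h2 := ler_wpM2r (mulr_ge0 (v0 i) (v0 j)) dhi.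
have h3 := ler_wpM2r (mulr_ge0 (u0 i) (v0 j)) dlo.
have h4 := ler_wpM2r (mulr_ge0 (v0 i) (u0 j)) dlo.
lra.
Qed.

Let gap := negative_type_gap X 0.

Lemma negative_type_of_bounds : 0 <= p -> 0 <= hi -> hi * (1 - gap) <= lo ->
  negative_type X p.
Proof.
move=> p0 hi0 h k x eta _ xI eta0; apply: le_trans (form_le _ _ _ p0 xI eta0) _.
have := ler_wpM2l hi0 (gap0_sum_sqr _ _ _ xI eta0).
set s := \sum_(i | _) _; rewrite -/gap => g.
have s2 : 0 <= 2 * s ^+ 2 by rewrite mulr_ge0 ?sqr_ge0.
have := ler_wpM2l s2 h; lra.
Qed.

Lemma strict_form_of_bounds (k : nat) (x : 'I_k -> X) (eta : 'I_k -> R) :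
  0 <= p -> 0 <= hi -> hi * (1 - gap) < lo ->
  injective x -> \sum_i eta i = 0 -> (exists i, eta i != 0) ->
  \sum_(i < k) \sum_(j < k) dist_pow p (x i) (x j) * eta i * eta j < 0.
Proof.
move=> p0 hi0 h xI eta0 [i0 e0].
apply: le_lt_trans (form_le _ _ _ p0 xI eta0) _.
have := ler_wpM2l hi0 (gap0_sum_sqr _ _ _ xI eta0).
set s := \sum_(i | _) _; rewrite -/gap => g.
(* Strictness needs positive mass: if [s] were 0, no [eta i] would be positive, and the zero sum
   would force [eta = 0]. *)
have s_gt0 : 0 < s.
  rewrite lt_neqAle sumr_ge0 ?andbT; last by move=> i /ltW.
  apply/eqP => s0; have eta_le0 i : eta i <= 0.
    rewrite leNgt; apply/negP => ei; have := ei.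
    by rewrite (psumr_eq0P _ (esym s0)) ?ltxx // => j /ltW.
  have eta_ge0 i : true -> 0 <= - eta i by rewrite oppr_ge0.
  have := psumr_eq0P eta_ge0; rewrite sumrN eta0 oppr0 => /(_ erefl i0 isT) /eqP.
  by rewrite oppr_eq0 (negbTE e0).
have s2 : 0 < 2 * s ^+ 2 by rewrite mulr_gt0 ?exprn_gt0.
have : 2 * s ^+ 2 * (hi * (1 - gap)) < 2 * s ^+ 2 * lo by rewrite ltr_pM2l.
lra.
Qed.

End Form.

End Gap.

(** * Distance bounds in a finite space *)

Section Finite.
Context {R : realType} (X : metricType R) (n : nat).
Hypothesis cardX : ([set: X] #= `I_n)%card.

Lemma mdist_le_diam (x y : X) : mdist x y <= diam X.
Proof.
have [f [g fK gK]] := card_setT_ord_bij _ _ cardX.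
apply: ub_le_sup; last by exists x, y.
(* The sum of all distances serves as an upper bound, so that the supremum is meaningful. *)
exists (\sum_i \sum_j mdist (f i) (f j)) => _ [a [b ->]].
rewrite -(gK a) -(gK b) (bigD1 (g a)) //= (bigD1 (g b)) //= -addrA lerDl.
by rewrite addr_ge0 ?sumr_ge0 // => i _; rewrite ?sumr_ge0 // => *; rewrite mdist_ge0.
Qed.

Lemma min_dist_le (x y : X) : x != y -> min_dist X <= mdist x y.
Proof.
move=> xy; apply: ge_inf; last by exists x, y.
by exists 0 => _ [a [b [_ ->]]]; rewrite mdist_ge0.
Qed.

Lemma min_dist_gt0 (x y : X) : x != y -> 0 < min_dist X.
Proof.
move=> xy; have [f [g fK gK]] := card_setT_ord_bij _ _ cardX.
(* A minimum of finitely many positive numbers, started at the harmless value 1, is a positive lower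
   bound for the infimum. *)
pose e := \big[Num.min/1]_(ij : 'I_n * 'I_n | ij.1 != ij.2)
  mdist (f ij.1) (f ij.2).
have e_gt0 : 0 < e.
  by apply: lt_bigmin => // ij; rewrite mdist_gt0 (can_eq fK).
apply: lt_le_trans e_gt0 _; apply: lb_le_inf; first by exists (mdist x y), x, y.
move=> _ [a [b [ab ->]]]; rewrite -(gK a) -(gK b).
have gab : (g a, g b).1 != (g a, g b).2 by rewrite /= (can_eq gK).
exact: (@bigmin_le_cond _ _ _ _ _ _ (fun ij => mdist (f ij.1) (f ij.2)) gab).
Qed.

Lemma dist_pow_bounded (p : R) (x y : X) : 0 <= p -> x != y ->
  min_dist X `^ p <= dist_pow p x y <= diam X `^ p.
Proof.
move=> p0 xy; have m0 := min_dist_gt0 _ _ xy.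
have dE : dist_pow p x y = mdist x y `^ p.
  (* Off the diagonal the convention for p = 0 agrees with [powR]: both give 1. *)
  by rewrite /dist_pow; case: eqP => // ->; rewrite xy powRr0.
have M0 : 0 <= diam X := le_trans (mdist_ge0 x y) (mdist_le_diam x y).
by rewrite dE !ge0_ler_powR ?nnegrE ?mdist_le_diam ?min_dist_le ?mdist_ge0 ?(ltW m0).
Qed.

Lemma gap0_le_34 : (3 <= n)%N -> negative_type_gap X 0 <= 3 / 4.
Proof.
move=> n3; have [f fB] := card_setT_ord_bij _ _ cardX.
pose x (i : 'I_3) := f (widen_ord n3 i).
have xI : injective x by move=> i j /(bij_inj fB) /(congr1 val) /= /val_inj.
(* Here the positive mass is 2 and the squares sum to 6, so 8 times the gap is at most 6. *)
pose eta (i : 'I_3) : R := if val i == 0%N then 2 else -1.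
have s2 : \sum_(i | 0 < eta i) eta i = 2.
  rewrite big_mkcond !big_ord_recl big_ord0 /eta /=.
  by rewrite ltr0n /= oppr_gt0 ltr10 !addr0.
have := gap0_sum_sqr X 3 x eta xI.
rewrite s2 !big_ord_recl !big_ord0 /eta /= => /(_ ltac:(lra)); lra.
Qed.

End Finite.

(** * From [zeta] to the power inequality *)

Lemma powR_lnE (R : realType) (a p : R) : 0 < a -> a `^ p = expR (p * ln a).
Proof. by move=> a0; rewrite /powR gt_eqF. Qed.

Theorem theorem4p1 (R : realType) (X : metricType R) (n : nat)
    (cardX : ([set: X] #= `I_n)%card) (n_ge3 : (3 <= n)%N) :
  (forall p : R, 0 <= p -> (p%:E <= zeta X)%E -> negative_type X p) /\
  (forall p : R, 0 <= p -> (p%:E < zeta X)%E -> strict_negative_type X p).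
Proof.
have [f fB] := card_setT_ord_bij _ _ cardX.
have [x [y xy]] : exists x y : X, x != y.
  exists (f (widen_ord n_ge3 0)), (f (widen_ord n_ge3 1)).
  by rewrite (inj_eq (bij_inj fB)).
have m0 := min_dist_gt0 X n cardX _ _ xy.
have mM : min_dist X <= diam X.
  exact: le_trans (min_dist_le X _ _ xy) (mdist_le_diam X n cardX x y).
have M0 := lt_le_trans m0 mM.
have bounds p (p0 : 0 <= p) a b (ab : a != b) :=
  dist_pow_bounded X n cardX p a b p0 ab.
have Mp0 p : 0 <= diam X `^ p by rewrite ltW // powR_gt0.
rewrite /zeta; case: ifPn => [/eqP D1|D1].
  (* Scaled diameter 1: all nonzero distances agree, so [hi = lo] in [form_le] and only the negative
     term with the squares is left, for every p. *)
  have mME : min_dist X = diam X.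
    by have := divfK (lt0r_neq0 m0) (diam X); rewrite -/(scaled_diam X) D1 mul1r.
  have S (p : R) : 0 <= p -> strict_negative_type X p.
    move=> p0; apply: strict_negative_type_of_form => k z eta zI eta0 [i ei].
    apply: le_lt_trans (form_le _ _ _ _ (bounds p p0) _ _ _ p0 zI eta0) _.
    rewrite mME subrr mulr0 sub0r oppr_lt0 mulr_gt0 ?powR_gt0 //.
    rewrite (bigD1 i) //= ltr_pwDl ?exprn_even_gt0 //.
    by rewrite sumr_ge0 // => j _; rewrite sqr_ge0.
  by split=> p p0 _; have [] := S p p0.
have D_gt1 : 1 < scaled_diam X.
  by rewrite lt_neqAle eq_sym D1 /scaled_diam ler_pdivlMr // mul1r.
have lnD := ln_gt0 D_gt1.
have D_gt0 := lt_trans ltr01 D_gt1.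
have g1 : 0 < 1 - negative_type_gap X 0.
  by have := gap0_le_34 X n cardX n_ge3; lra.
(* Exponentiating [p <= zeta] bounds [scaled_diam X] to the power p by [1 / (1 - gap)]; multiplying
   by the p-th power of [min_dist X] gives [hi * (1 - gap) <= lo]. *)
have MpE p : diam X `^ p = scaled_diam X `^ p * min_dist X `^ p.
  by rewrite -powRM ?divfK ?gt_eqF // ltW.
have lnK1 : expR (ln (1 / (1 - negative_type_gap X 0)))
    = 1 / (1 - negative_type_gap X 0).
  by rewrite lnK // posrE divr_gt0.
have W p : 0 <= p ->
    p <= ln (1 / (1 - negative_type_gap X 0)) / ln (scaled_diam X) ->
    negative_type X p.
  move=> p0; rewrite ler_pdivlMr // -ler_expR lnK1 -powR_lnE // => h.
  apply: (negative_type_of_bounds _ _ _ _ (bounds p p0) p0 (Mp0 p)).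
  rewrite MpE mulrAC -[leRHS]mul1r ler_wpM2r ?powR_ge0 //.
  by rewrite -ler_pdivlMr.
split=> p p0; rewrite ?lee_fin ?lte_fin; first exact: W.
(* The same passage with strict inequalities, as [expR] is strictly increasing. *)
rewrite ltr_pdivlMr // -ltr_expR lnK1 -powR_lnE // => h.
apply: strict_negative_type_of_form => k z eta zI eta0 e.
apply: (strict_form_of_bounds _ _ _ _ (bounds p p0) _ _ _ p0 (Mp0 p)) => //.
by rewrite MpE mulrAC -[ltRHS]mul1r ltr_pM2r ?powR_gt0 // -ltr_pdivlMr.
Qed.
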